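(* Let $N,d\ge 1$ be integers and let $\{W_k\}_{k\ge 0}$ be a deterministic sequence of nonnegative doubly stochastic matrices in $\mathbb{R}^{N\times N}$. Let $\Pi=\frac1N\mathbf 1\mathbf 1^{\mathsf T}$ and $\widetilde W_k=W_k-\Pi$, and suppose there are an integer $\tau\ge 1$ and a constant $\lambda\in[0,1)$ such that $$\bigl\|\widetilde W_{k+\tau-1}\widetilde W_{k+\tau-2}\cdots\widetilde W_{k}\bigr\|_2\le\lambda\qquad\text{for all }k\ge 0 .$$ Put $\Delta_\lambda=1-\lambda$, $\widetilde{\mathbf W}_k=\widetilde W_k\otimes I_d$, and $$\mathbf R_k=\delta\,\mathbf P_k,\qquad \delta=\frac{1-\lambda^2}{\tau},\qquad \mathbf P_k=\sum_{r=0}^{\infty}\mathbf\Psi(k+r,k)^{\mathsf T}\,\mathbf\Psi(k+r,k),$$ where $\mathbf\Psi(t,s)=\widetilde{\mathbf W}_{t-1}\widetilde{\mathbf W}_{t-2}\cdots\widetilde{\mathbf W}_{s}$ for $t>s$ and $\mathbf\Psi(s,s)=\mathbf I$. Then, for every $k\ge 0$, $$\delta\,\mathbf I\preceq\mathbf R_k\preceq\mathbf I,\qquad \widetilde{\mathbf W}_k^{\mathsf T}\,\mathbf R_{k+1}\,\widetilde{\mathbf W}_k=\mathbf R_k-\delta\,\mathbf I .$$ Moreover, $$\frac{\Delta_\lambda}{\tau}\le\delta=\frac{\Delta_\lambda(1+\lambda)}{\tau}\le\frac{2\Delta_\lambda}{\tau},\qquad 0<\delta\le\frac1\tau\le 1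 .$$
   Context: $\|\cdot\|_2$ is the spectral norm, $\mathbf 1\in\mathbb{R}^N$ is the all-ones vector, $\otimes$ is the Kronecker product, $\mathbf I$ is the $Nd\times Nd$ identity matrix, and $\preceq$ is the Loewner order on symmetric matrices. Doubly stochastic means nonnegative entries with $W_k\mathbf 1=\mathbf 1$ and $\mathbf 1^{\mathsf T}W_k=\mathbf 1^{\mathsf T}$. No symmetry of $W_k$ is assumed. *)

(* Defs.v *)
From HB Require Import structures.
From mathcomp Require Import all_boot all_order all_algebra.
From mathcomp Require Import all_classical all_reals all_analysis.
From mathcomp Require Import mxtens.

Set Implicit Arguments.
Unset Strict Implicit.
Unset Printing Implicit Defensive.

Import Order.TTheory GRing.Theory Num.Theory.
Import numFieldNormedType.Exports.

Local Open Scope classical_set_scope.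
Local Open Scope ring_scope.

Definition l2norm (R : realType) (n : nat) (x : 'cV[R]_n) : R :=
  Num.sqrt (\sum_(i < n) x i 0 ^+ 2).

(* The operator norm induced by l2norm; the norm that the library puts on
   matrices is the entrywise maximum. *)
Definition spectral_norm (R : realType) (m n : nat) (A : 'M[R]_(m, n)) : R :=
  sup [set l2norm (A *m x) | x in [set x : 'cV[R]_n | l2norm x <= 1]].

Definition doubly_stochastic (R : realType) (N : nat) (W : 'M[R]_N) : Prop :=
  [/\ forall i j, 0 <= W i j,
      W *m const_mx 1 = const_mx 1 :> 'cV[R]_N &
      const_mx 1 *m W = const_mx 1 :> 'rV[R]_N].

Definition loewner_le (R : realType) (n : nat) (A B : 'M[R]_n) : Prop :=
  [/\ A \is symmetricmx, B \is symmetricmx &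
      forall x : 'cV[R]_n, 0 <= (x^T *m (B - A) *m x) 0 0].

Definition avg_mx (R : realType) (N : nat) : 'M[R]_N :=
  N%:R^-1 *: (const_mx 1 *m (const_mx 1 : 'cV[R]_N)^T).

(* A (t - 1) *m A (t - 2) *m ... *m A s when s < t, and the identity when
   t <= s: the factor with the largest index is on the left. *)
Definition transition (R : realType) (n : nat) (A : nat -> 'M[R]_n)
    (t s : nat) : 'M[R]_n :=
  \prod_(i <- rev (index_iota s t)) A i.

Definition gramian_term (R : realType) (n : nat) (A : nat -> 'M[R]_n)
    (k r : nat) : 'M[R]_n :=
  (transition A (k + r) k)^T *m transition A (k + r) k.

(* The sum over r >= 0 of gramian_term A k r, meaningful only when the partial
   sums converge (entrywise): limn is unspecified otherwise. *)
Definition gramian (R : realType) (n : nat) (A : nat -> 'M[R]_n)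
    (k : nat) : 'M[R]_n :=
  limn (series (gramian_term A k)).

(* Main.v *)
Require Import Defs.
From mathcomp Require Import all_boot all_order all_algebra.
From mathcomp Require Import all_classical all_reals all_analysis.
From mathcomp Require Import mxtens.
From mathcomp Require Import ring lra.

Set Implicit Arguments.
Unset Strict Implicit.
Unset Printing Implicit Defensive.

Import Order.TTheory GRing.Theory Num.Theory.
Import numFieldNormedType.Exports.

Local Open Scope classical_set_scope.
Local Open Scope ring_scope.

(** P_k, the observability Gramian of the time-varying system x_{t+1} = bW_t x_t,
    solves the Lyapunov equation bW_k^T P_{k+1} bW_k = P_k - I as soon as the
    series converges, because dropping the first factor of every transition
    matrix shifts the series by one term. So everything rests on bounding
    x^T P_k x, the total energy sum_r |Psi(k+r,k) x|^2 of a trajectory.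

    Two estimates give that bound. A doubly stochastic W is nonexpansive for the
    Euclidean norm, by convexity of the square, and removing the average only
    decreases |W x| (sqnorm_sub_avg_le); and over a window of length tau the
    squared norm shrinks by lambda^2 (sqnorm_mul_spectral_le). Both survive the
    Kronecker product with the identity, which only stacks d independent copies
    of the system (sqnorm_tens1_le). If E is the least constant such that the
    energy is at most E |x|^2 for all starting times, splitting off the first
    window gives E <= tau + lambda^2 E, that is E <= tau / (1 - lambda^2)
    = 1 / delta; quad_series_blocks_le is this argument on finite sums. The
    term r = 0 alone gives the lower bound I <= P_k.

    Convergence comes from the same bound: the partial sums increase in the
    Loewner order and are bounded, and since the entries of a symmetric matrix
    are recovered from its quadratic form by polarization, such a sequence
    converges entrywise (loewner_le_lim). *)

(** * Quadratic forms and the Loewner order *)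

Definition quad (R : realType) (n : nat) (M : 'M[R]_n) (x : 'cV[R]_n) : R :=
  (x^T *m M *m x) 0 0.

Definition sqnorm (R : realType) (n : nat) (x : 'cV[R]_n) : R :=
  \sum_(i < n) x i 0 ^+ 2.

Section QuadraticForms.
Variables (R : realType) (n : nat).
Implicit Types (M S : 'M[R]_n) (x : 'cV[R]_n).

Lemma symmetricmxE M : (M \is symmetricmx) = (M == M^T).
Proof. by rewrite is_hermitianmxE expr0 scale1r map_mx_id. Qed.

Lemma quadE M x : quad M x = \sum_i \sum_j x i 0 * M i j * x j 0.
Proof.
rewrite /quad mxE exchange_big; apply: eq_bigr => j _ /=.
by rewrite mxE mulr_suml; apply: eq_bigr => i _; rewrite mxE.
Qed.

Lemma quadD M S x : quad (M + S) x = quad M x + quad S x.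
Proof. by rewrite /quad mulmxDr mulmxDl mxE. Qed.

Lemma quadZ a M x : quad (a *: M) x = a * quad M x.
Proof. by rewrite /quad -scalemxAr -scalemxAl mxE. Qed.

Lemma quadB M S x : quad (M - S) x = quad M x - quad S x.
Proof. by rewrite quadD -scaleN1r quadZ mulN1r. Qed.

Lemma quad_sum (I : Type) (r : seq I) (F : I -> 'M[R]_n) x :
  quad (\sum_(i <- r) F i) x = \sum_(i <- r) quad (F i) x.
Proof.
elim/big_rec2: _ => [|i y M _ <-]; last by rewrite quadD.
by rewrite /quad mulmx0 mul0mx mxE.
Qed.

Lemma quad_gram m (A : 'M[R]_(m, n)) x : quad (A^T *m A) x = sqnorm (A *m x).
Proof.
rewrite /quad mulmxA -mulmxA -trmx_mul mxE.
by apply: eq_bigr => i _; rewrite mxE expr2.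
Qed.

Lemma quad1 x : quad 1%:M x = sqnorm x.
Proof. by rewrite -[in RHS](mul1mx x) -quad_gram trmx1 mul1mx. Qed.

Lemma sqnorm_ge0 x : 0 <= sqnorm x.
Proof. by apply: sumr_ge0 => i _; exact: sqr_ge0. Qed.

Lemma sqnorm0 : sqnorm (0 : 'cV[R]_n) = 0.
Proof. by apply: big1 => i _; rewrite mxE expr0n. Qed.

Lemma sqnormZ a x : sqnorm (a *: x) = a ^+ 2 * sqnorm x.
Proof. by rewrite mulr_sumr; apply: eq_bigr => i _; rewrite mxE exprMn. Qed.

Lemma loewner_leP M S :
  loewner_le M S <->
  [/\ M \is symmetricmx, S \is symmetricmx & forall x, quad M x <= quad S x].
Proof.
by split=> -[sM sS h]; split=> // x; have := h x;
  rewrite -/(quad (S - M) x) quadB subr_ge0.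
Qed.

Lemma loewner_leZ a M S : 0 <= a -> loewner_le M S ->
  loewner_le (a *: M) (a *: S).
Proof.
move=> a0 /loewner_leP[sM sS MS].
have symZ (B : 'M[R]_n) : B \is symmetricmx -> a *: B \is symmetricmx.
  by rewrite !symmetricmxE linearZ /= => /eqP <-.
by apply/loewner_leP; split; [exact: symZ..|move=> x; rewrite !quadZ ler_wpM2l].
Qed.

(** Reduces convergence of a sequence of symmetric matrices to convergence of
    its quadratic forms. *)
Lemma symmetricmx_polarization M (i j : 'I_n) : M \is symmetricmx ->
  M i j = (quad M (delta_mx i 0 + delta_mx j 0)
           - quad M (delta_mx i 0) - quad M (delta_mx j 0)) / 2.
Proof.
rewrite symmetricmxE => /eqP sM.
have entry k l : ((delta_mx k 0 : 'cV[R]_n)^T *m M *m delta_mx l 0) 0 0 = M k l.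
  rewrite trmx_delta -rowE mxE (bigD1 l)//= big1 => [|h hl]; rewrite !mxE.
    by rewrite !eqxx mulr1 addr0.
  by rewrite (negPf hl) mulr0.
have add00 (B C : 'M[R]_1) : (B + C) 0 0 = B 0 0 + C 0 0 by rewrite mxE.
rewrite /quad [(_ + _)^T]linearD /= !(mulmxDl, mulmxDr) !add00 !entry.
have -> : M j i = M i j by rewrite [LHS](congr1 (fun B : 'M[R]_n => B j i) sM) mxE.
by field.
Qed.

End QuadraticForms.

(** * The spectral norm as a bound on squared norms *)

Section SpectralNorm.
Variables (R : realType) (m n : nat).
Implicit Types (A : 'M[R]_(m, n)) (x : 'cV[R]_n).

Lemma l2norm_le k (x : 'cV[R]_k) c :
  0 <= c -> (l2norm x <= c) = (sqnorm x <= c ^+ 2).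
Proof.
by move=> c0; rewrite -[in LHS](ger0_norm c0) -sqrtr_sqr ler_sqrt ?sqr_ge0.
Qed.

(** Without it the supremum defining the spectral norm would carry no
    information. Each coordinate of a unit vector is at most 1 in absolute
    value, so absolute row sums bound the coordinates of the image. *)
Lemma has_ubound_unit_ball_image A :
  has_ubound [set l2norm (A *m x) | x in [set x : 'cV[R]_n | l2norm x <= 1]].
Proof.
exists (Num.sqrt (\sum_i (\sum_j `|A i j|) ^+ 2)) => _ [x /= x1 <-].
have xj1 j : `|x j 0| <= 1.
  rewrite -ler_sqr ?nnegrE// expr1n real_normK ?num_real//.
  move: x1; rewrite l2norm_le// expr1n; apply: le_trans.
  by rewrite /sqnorm (bigD1 j)//= lerDl sumr_ge0// => i _; exact: sqr_ge0.
rewrite ler_sqrt; last by apply: sumr_ge0 => i _; exact: sqr_ge0.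
apply: ler_sum => i _; rewrite -real_normK ?num_real// ler_sqr ?nnegrE//.
  rewrite mxE (le_trans (ler_norm_sum _ _ _))//; apply: ler_sum => j _.
  by rewrite normrM ler_piMr.
by apply: sumr_ge0.
Qed.

(** Homogeneity: the case of the unit ball, which is the definition of the norm,
    is applied to x divided by its length. *)
Lemma sqnorm_mul_spectral_le A c x : spectral_norm A <= c ->
  sqnorm (A *m x) <= c ^+ 2 * sqnorm x.
Proof.
move=> Ac.
have unit_ball y : sqnorm y <= 1 -> l2norm (A *m y) <= c.
  move=> y1; apply: le_trans Ac.
  apply: ub_le_sup; first exact: has_ubound_unit_ball_image.
  by exists y => //=; rewrite l2norm_le// expr1n.
have c0 : 0 <= c.
  apply: le_trans (unit_ball 0 _); first exact: sqrtr_ge0.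
  by rewrite sqnorm0.
have [x0|x0] := eqVneq (sqnorm x) 0.
  suff -> : x = 0 by rewrite mulmx0 !sqnorm0 mulr0.
  apply/matrixP => i j; rewrite ord1 mxE; apply/eqP; rewrite -sqrf_eq0.
  apply/eqP; move/eqP: x0; rewrite psumr_eq0 => [/allP/(_ i)|? _]; last exact: sqr_ge0.
  by move=> /(_ (mem_index_enum _)) /eqP.
have xgt0 : 0 < sqnorm x by rewrite lt_def x0 sqnorm_ge0.
have := unit_ball ((Num.sqrt (sqnorm x))^-1 *: x).
rewrite sqnormZ exprVn sqr_sqrtr ?sqnorm_ge0// mulVf// => /(_ (lexx _)).
rewrite l2norm_le// -scalemxAr sqnormZ exprVn sqr_sqrtr ?sqnorm_ge0//.
by rewrite mulrC ler_pdivrMr.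
Qed.

End SpectralNorm.

(** * Contraction by centered doubly stochastic matrices *)

Section DoublyStochastic.
Variables (R : realType) (N : nat).
Implicit Types (W : 'M[R]_N) (x : 'cV[R]_N).

(** Jensen's inequality for the square: the gap between the two sides is the
    variance of y under the weights w. *)
Lemma sqr_convex_comb_le (w y : 'I_N -> R) :
  (forall j, 0 <= w j) -> \sum_j w j = 1 ->
  (\sum_j w j * y j) ^+ 2 <= \sum_j w j * y j ^+ 2.
Proof.
move=> w0 w1; set mu := \sum_j w j * y j.
have : 0 <= \sum_j w j * (y j - mu) ^+ 2.
  by apply: sumr_ge0 => j _; rewrite mulr_ge0 ?sqr_ge0.
have -> : \sum_j w j * (y j - mu) ^+ 2 =
    \sum_j w j * y j ^+ 2 - mu *+ 2 * (\sum_j w j * y j)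
    + mu ^+ 2 * \sum_j w j.
  rewrite !mulr_sumr -sumrB -big_split /=; apply: eq_bigr => j _.
  by ring.
by rewrite -/mu w1; nra.
Qed.

(** Unit row sums allow Jensen's inequality in each row; unit column sums say
    that each entry of x then gets total weight 1. *)
Lemma sqnorm_doubly_stochastic_le W x :
  doubly_stochastic W -> sqnorm (W *m x) <= sqnorm x.
Proof.
move=> [W0 Wrow Wcol].
have row1 i : \sum_j W i j = 1.
  have /matrixP/(_ i 0) := Wrow; rewrite !mxE => <-.
  by apply: eq_bigr => j _; rewrite mxE mulr1.
have col1 j : \sum_i W i j = 1.
  have /matrixP/(_ 0 j) := Wcol; rewrite !mxE => <-.
  by apply: eq_bigr => i _; rewrite mxE mul1r.
apply: (@le_trans _ _ (\sum_i \sum_j W i j * x j 0 ^+ 2)).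
  by apply: ler_sum => i _; rewrite mxE sqr_convex_comb_le.
rewrite exchange_big; apply: ler_sum => j _ /=.
by rewrite -mulr_suml col1 mul1r.
Qed.

(** W preserves the sum s of the entries, so the constant vector of entries s / N
    is the orthogonal projection of W x on the constants, and subtracting it
    removes s^2 / N from the squared norm (Pythagoras). *)
Lemma sqnorm_sub_avg_le W x :
  doubly_stochastic W -> sqnorm ((W - avg_mx R N) *m x) <= sqnorm x.
Proof.
move=> dsW; apply: le_trans (sqnorm_doubly_stochastic_le x dsW).
case: dsW => _ _ Wcol.
set y := W *m x; set s := \sum_i y i 0.
have xs : \sum_j x j 0 = s.
  have : (const_mx 1 : 'rV[R]_N) *m y = const_mx 1 *m x by rewrite mulmxA Wcol.
  move=> /matrixP/(_ 0 0); rewrite !mxE.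
  under eq_bigr do rewrite mxE mul1r.
  by under [in RHS]eq_bigr do rewrite mxE mul1r.
have avgx i : (avg_mx R N *m x) i 0 = N%:R^-1 * s.
  rewrite -scalemxAl mxE -mulmxA mxE big_ord1 mxE mul1r mxE -xs; congr (_ * _).
  by apply: eq_bigr => j _; rewrite !mxE mul1r.
have centeredE i : ((W - avg_mx R N) *m x) i 0 = y i 0 - N%:R^-1 * s.
  by rewrite mulmxBl -(avgx i) [LHS]mxE [X in _ + X]mxE.
(* With N = 0 the average is divided by 0, hence vanishes. *)
have [N0|N0] := eqVneq (N%:R : R) 0.
  by apply: ler_sum => i _; rewrite centeredE N0 invr0 mul0r subr0.
have -> : sqnorm ((W - avg_mx R N) *m x) = sqnorm y - N%:R^-1 * s ^+ 2.
  rewrite /sqnorm; under eq_bigr do rewrite centeredE sqrrB.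
  rewrite big_split sumrB /= sumr_const card_ord sumrMnl -mulr_suml -/s.
  by rewrite -[X in _ + X]mulr_natl; field.
by rewrite gerBl mulr_ge0 ?sqr_ge0// invr_ge0 ler0n.
Qed.

End DoublyStochastic.

(** * Kronecker products with the identity *)

Section Kronecker.
Variables (R : realType).

Lemma big_mxtens_index (m n : nat) (F : 'I_(m * n) -> R) :
  \sum_k F k = \sum_j \sum_i F (mxtens_index (i, j)).
Proof.
rewrite exchange_big pair_big /=.
rewrite (reindex (@mxtens_index m n)) /=; last first.
  exists (@mxtens_unindex m n) => k _.
    exact: mxtens_indexK.
  exact: mxtens_unindexK.
by apply: eq_bigr => -[].
Qed.

(** A vector of the product splits into d slices, one for each index j of the
    second factor, and A acts on each of them separately: y below is a slice. *)
Lemma sqnorm_tens1_le (m n d : nat) (A : 'M[R]_(m, n)) c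
    (x : 'cV[R]_(n * d)) :
  (forall y, sqnorm (A *m y) <= c * sqnorm y) ->
  sqnorm ((A *t (1%:M : 'M[R]_d)) *m x) <= c * sqnorm x.
Proof.
move=> Ac; rewrite /sqnorm !big_mxtens_index mulr_sumr.
apply: ler_sum => j _.
pose y := \col_i x (mxtens_index (i, j)) 0.
suff -> : \sum_i ((A *t (1%:M : 'M[R]_d)) *m x) (mxtens_index (i, j)) 0 ^+ 2
    = sqnorm (A *m y).
  apply: le_trans (Ac y) _; rewrite le_eqVlt; apply/orP; left; apply/eqP.
  by congr (_ * _); apply: eq_bigr => i _; rewrite mxE.
apply: eq_bigr => i _; congr (_ ^+ 2); rewrite !mxE big_mxtens_index.
rewrite (bigD1 j)//= [X in _ + X]big1 ?addr0 => [|l lj].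
  by apply: eq_bigr => k _; rewrite tensmxE !mxE eqxx mulr1.
by apply: big1 => k _; rewrite tensmxE mxE eq_sym (negPf lj) mulr0 mul0r.
Qed.

Lemma transition_tens1 (n d : nat) (A : nat -> 'M[R]_n) t s :
  transition (fun k => A k *t (1%:M : 'M[R]_d)) t s
  = transition A t s *t (1%:M : 'M[R]_d).
Proof.
rewrite /transition; elim: (rev _) => [|i r IH]; last first.
  by rewrite !big_cons IH [LHS]tensmx_mul mul1mx.
rewrite !big_nil; apply/matrixP => i j.
case: (mxtens_indexP i) => i1 i2; case: (mxtens_indexP j) => j1 j2.
rewrite tensmxE !mxE -natrM mulnb (can_eq (@mxtens_indexK _ _)).
by rewrite xpair_eqE.
Qed.

End Kronecker.

(** * Monotone limits of symmetric matrices *)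

Section MatrixLimits.
Variables (R : realType) (n : nat).
Implicit Types (S : nat -> 'M[R]_n) (L : 'M[R]_n).

(** The neighbourhoods of a matrix are those of the product topology. *)
Lemma cvgn_mxP S L :
  S @ \oo --> L <-> forall i j, (fun r => S r i j) @ \oo --> L i j.
Proof.
split=> [SL i j|SL P [Q LQ QP]].
  exact: (continuous_cvg _ (@coord_continuous _ _ _ i j L) SL).
suff H : \forall r \near \oo, forall i j, Q i j (S r i j).
  by apply: filterS H => r /QP.
apply: filter_forall => i; apply: filter_forall => j.
exact: SL (LQ i j).
Qed.

Lemma cvg_sumr (I : Type) (r : seq I) (F : I -> nat -> R) (l : I -> R) :
  (forall i, F i @ \oo --> l i) ->
  (fun k => \sum_(i <- r) F i k) @ \oo --> \sum_(i <- r) l i.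
Proof. by move=> Fl; apply: cvg_big => [|i _]; [exact: add_continuous|exact: Fl]. Qed.

Lemma cvgn_quad S L x : S @ \oo --> L -> (fun r => quad (S r) x) @ \oo --> quad L x.
Proof.
move=> /cvgn_mxP SL; rewrite quadE.
under eq_fun do rewrite quadE.
apply: cvg_sumr => i; apply: cvg_sumr => j.
by apply: cvgMr_tmp; apply: cvgMl_tmp; exact: SL.
Qed.

Lemma cvgn_mulmx S L (B C : 'M[R]_n) :
  S @ \oo --> L -> (fun r => B *m S r *m C) @ \oo --> B *m L *m C.
Proof.
move=> /cvgn_mxP SL; apply/cvgn_mxP => i j; rewrite mxE.
under eq_fun do rewrite mxE.
apply: cvg_sumr => k; rewrite mxE.
under eq_fun do rewrite mxE.
by apply: cvgMr_tmp; apply: cvg_sumr => l; apply: cvgMl_tmp; exact: SL.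
Qed.

Lemma symmetricmx_lim S L : (forall r, S r \is symmetricmx) ->
  S @ \oo --> L -> L \is symmetricmx.
Proof.
move=> sS /cvgn_mxP SL; rewrite symmetricmxE; apply/eqP/matrixP => i j.
rewrite mxE; apply: (cvg_unique _ (SL i j)) => //.
rewrite (_ : (fun r => S r i j) = fun r => S r j i);
  first exact: SL.
by apply/funext => r; move: (sS r); rewrite symmetricmxE => /eqP{1}->; rewrite mxE.
Qed.

(** The quadratic form at each vector is a bounded nondecreasing real sequence,
    and polarization turns these limits into limits of the entries. *)
Lemma loewner_le_lim S B : (forall r, loewner_le (S r) (S r.+1)) ->
    (forall r, loewner_le (S r) B) ->
  [/\ cvgn S, forall r, loewner_le (S r) (limn S) & loewner_le (limn S) B].
Proof.
move=> Smono SB.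
have sS r : S r \is symmetricmx by case: (Smono r).
have ndS x : nondecreasing_seq (fun r => quad (S r) x).
  by apply/nondecreasing_seqP => r; have /loewner_leP[] := Smono r.
have quad_cvg x : cvgn (fun r => quad (S r) x).
  apply: nondecreasing_is_cvgn => //; exists (quad B x) => _ [r _ <-].
  by have /loewner_leP[] := SB r.
have Scvg : cvgn S.
  apply/cvg_ex; exists (\matrix_(i, j) limn (fun r => S r i j)).
  apply/cvgn_mxP => i j; rewrite mxE.
  under eq_fun => r do rewrite (symmetricmx_polarization i j (sS r)).
  apply: is_cvgMr_tmp; apply: is_cvgB; [apply: is_cvgB|]; exact: quad_cvg.
have Sq x : (fun r => quad (S r) x) @ \oo --> quad (limn S) x by exact: cvgn_quad.
have sL := symmetricmx_lim sS Scvg.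
split=> // [r|]; apply/loewner_leP; split=> //.
- by move=> x; rewrite -(cvg_lim _ (Sq x))//; apply: nondecreasing_cvgn_le.
- by case: (SB 0%N).
- move=> x; rewrite -(cvg_lim _ (Sq x))//; apply: limr_le => //.
  by near=> r; have /loewner_leP[] := SB r.
Unshelve. all: by end_near. Qed.

End MatrixLimits.

(** * Transition matrices and partial sums of the Gramian *)

Section Transition.
Variables (R : realType) (n : nat) (A : nat -> 'M[R]_n).

Lemma transition_id k : transition A k k = 1%:M.
Proof. by rewrite /transition /index_iota subnn big_nil. Qed.

Lemma transitionD k a b :
  transition A (k + (a + b)) k
  = transition A (k + a + b) (k + a) *m transition A (k + a) k.
Proof. by rewrite /transition /index_iota !addKn iotaD rev_cat big_cat. Qed.

Lemma transition1 k : transition A (k + 1) k = A k.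
Proof. by rewrite /transition /index_iota addKn big_seq1. Qed.

Lemma gramian_term_sym k r : gramian_term A k r \is symmetricmx.
Proof. by rewrite symmetricmxE trmx_mul trmxK. Qed.

Lemma series_gramian_term_sym k m : series (gramian_term A k) m \is symmetricmx.
Proof.
rewrite symmetricmxE /series /= linear_sum /=; apply/eqP/eq_bigr => r _.
by apply/eqP; rewrite -symmetricmxE gramian_term_sym.
Qed.

(** Restarting the system at time k + a. With a = 1 this is the Lyapunov equation
    for partial sums; with a = tau it isolates the first window. *)
Lemma series_gramian_termD k a b :
  series (gramian_term A k) (a + b)%N = series (gramian_term A k) a
    + (transition A (k + a) k)^T *m series (gramian_term A (k + a)) b
      *m transition A (k + a) k.
Proof.
rewrite /series /= (@big_cat_nat _ _ _ a)//= ?leq_addr//; congr (_ + _).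
rewrite -[X in \sum_(X <= _ < _) _]add0n big_addn addKn mulmx_sumr mulmx_suml.
apply: eq_bigr => r _; rewrite /gramian_term [(r + a)%N]addnC transitionD trmx_mul.
by rewrite !mulmxA.
Qed.

Lemma quad_gramian_term k r x :
  quad (gramian_term A k r) x = sqnorm (transition A (k + r) k *m x).
Proof. exact: quad_gram. Qed.

Lemma quad_series_gramian_termD k a b x :
  quad (series (gramian_term A k) (a + b)%N) x
  = quad (series (gramian_term A k) a) x
    + quad (series (gramian_term A (k + a)) b) (transition A (k + a) k *m x).
Proof.
by rewrite series_gramian_termD quadD /quad trmx_mul !mulmxA.
Qed.

Lemma quad_series_gramian_term_ge0 k m x :
  0 <= quad (series (gramian_term A k) m) x.
Proof.
rewrite quad_sum; apply: sumr_ge0 => r _.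
by rewrite quad_gramian_term sqnorm_ge0.
Qed.

End Transition.

(** * The Gramian of a uniformly contracting system *)

Section Gramian.
Variables (R : realType) (n : nat) (A : nat -> 'M[R]_n) (tau : nat) (c : R).
Hypothesis tau_gt0 : (0 < tau)%N.
Hypothesis c_lt1 : c < 1.
Hypothesis nonexpansive : forall k x, sqnorm (A k *m x) <= sqnorm x.
Hypothesis decay :
  forall k x, sqnorm (transition A (k + tau) k *m x) <= c * sqnorm x.

Lemma sqnorm_transition_le k r x :
  sqnorm (transition A (k + r) k *m x) <= sqnorm x.
Proof.
elim: r => [|r IH]; first by rewrite addn0 transition_id mul1mx.
rewrite -(addn1 r) transitionD transition1 -mulmxA.
exact: le_trans (nonexpansive _ _) IH.
Qed.

Lemma quad_series_block_le k x :
  quad (series (gramian_term A k) tau) x <= tau%:R * sqnorm x.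
Proof.
rewrite quad_sum; apply: (@le_trans _ _ (\sum_(0 <= r < tau) sqnorm x)).
  by apply: ler_sum => r _; rewrite quad_gramian_term sqnorm_transition_le.
by rewrite big_const_nat subn0 iter_addr_0 mulr_natl.
Qed.

(** With T = tau |x|^2, the first window contributes at most T, and the
    remaining ones start from a vector of squared norm at most c |x|^2, so
    (1 - c) times the total is at most (1 - c) T + c T = T. *)
Lemma quad_series_blocks_le k j x :
  (1 - c) * quad (series (gramian_term A k) (j * tau)%N) x <= tau%:R * sqnorm x.
Proof.
elim: j k x => [|j IH] k x.
  by rewrite mul0n quad_sum big_geq// mulr0 mulr_ge0 ?sqnorm_ge0.
rewrite mulSn quad_series_gramian_termD.
have tail : (1 - c) * quad (series (gramian_term A (k + tau)) (j * tau)%N)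
    (transition A (k + tau) k *m x) <= tau%:R * (c * sqnorm x).
  by apply: le_trans (IH _ _) _; rewrite ler_wpM2l.
have head : (1 - c) * quad (series (gramian_term A k) tau) x
    <= (1 - c) * (tau%:R * sqnorm x).
  by rewrite ler_wpM2l ?quad_series_block_le// subr_ge0 ltW.
by rewrite mulrDr; apply: le_trans (lerD head tail) _; rewrite le_eqVlt;
  apply/orP; left; apply/eqP; ring.
Qed.

(** The terms are nonnegative, so m of them are dominated by m full windows. *)
Lemma quad_series_le k m x :
  quad (series (gramian_term A k) m) x <= tau%:R / (1 - c) * sqnorm x.
Proof.
have c1 : 0 < 1 - c by rewrite subr_gt0.
rewrite mulrAC ler_pdivlMr// mulrC.
apply: le_trans (quad_series_blocks_le k m x); rewrite ler_pM2l//.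
rewrite -(subnKC (leq_pmulr m tau_gt0)) quad_series_gramian_termD lerDl.
exact: quad_series_gramian_term_ge0.
Qed.

(** The lower bound is the partial sum of length one, which is the identity. *)
Lemma gramian_spec k :
  [/\ cvgn (series (gramian_term A k)),
      loewner_le 1%:M (gramian A k) &
      loewner_le (gramian A k) (tau%:R / (1 - c) *: 1%:M)].
Proof.
have scalar_sym a : a *: (1%:M : 'M[R]_n) \is symmetricmx.
  by rewrite symmetricmxE linearZ /= trmx1.
have [||Scvg Sle leS] := @loewner_le_lim R n (series (gramian_term A k))
  (tau%:R / (1 - c) *: 1%:M).
- move=> m; apply/loewner_leP; split; try exact: series_gramian_term_sym.
  by move=> x; rewrite seriesSr quadD lerDl quad_gramian_term sqnorm_ge0.
- move=> m; apply/loewner_leP; split=> //; first exact: series_gramian_term_sym.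
  by move=> x; rewrite quadZ quad1 quad_series_le.
split=> //; have := Sle 1%N.
by rewrite /series /= big_nat1 /gramian_term addn0 transition_id trmx1 mul1mx.
Qed.

(** Both sides are limits of the same sequence: conjugating the partial sums
    started at k + 1 gives those started at k, one term longer, minus the
    identity. *)
Lemma gramian_lyapunov k :
  (A k)^T *m gramian A k.+1 *m A k = gramian A k - 1%:M.
Proof.
have [Scvg _ _] := gramian_spec k; have [Scvg1 _ _] := gramian_spec k.+1.
apply: (@cvg_unique _ (@norm_hausdorff _ _) (
   (fun m => (A k)^T *m series (gramian_term A k.+1) m *m A k) @ \oo)).
  exact: cvgn_mulmx.
have -> : (fun m => (A k)^T *m series (gramian_term A k.+1) m *m A k)
    = (fun m => series (gramian_term A k) m.+1 - 1%:M).
  apply: eq_fun => m; rewrite -(add1n m) series_gramian_termD transition1 addn1.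
  rewrite {2}/series /= big_nat1 /gramian_term addn0 transition_id trmx1 mul1mx.
  by rewrite addrC addKr.
apply: cvgB; last exact: cvg_cst.
by rewrite (cvg_shiftS (series (gramian_term A k))).
Qed.

End Gramian.

(** * The Lyapunov matrices of the consensus system *)

Theorem lemma2 (R : realType) (N d : nat) (hN : (1 <= N)%N) (hd : (1 <= d)%N)
    (W : nat -> 'M[R]_N) (hW : forall k, doubly_stochastic (W k))
    (tau : nat) (htau : (1 <= tau)%N)
    (lambda : R) (hlambda0 : 0 <= lambda) (hlambda1 : lambda < 1) :
  let Wt : nat -> 'M[R]_N := fun k => W k - avg_mx R N in
  (forall k, spectral_norm (transition Wt (k + tau)%N k) <= lambda) ->
  let Delta : R := 1 - lambda in
  let delta : R := (1 - lambda ^+ 2) / tau%:R in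
  let bW : nat -> 'M[R]_(N * d) := fun k => Wt k *t (1%:M : 'M[R]_d) in
  let bR : nat -> 'M[R]_(N * d) := fun k => delta *: gramian bW k in
  [/\ forall k, cvgn (series (gramian_term bW k)),
      forall k,
        [/\ loewner_le (delta *: 1%:M) (bR k),
            loewner_le (bR k) 1%:M &
            (bW k)^T *m bR k.+1 *m bW k = bR k - delta *: 1%:M],
      [/\ Delta / tau%:R <= delta,
          delta = Delta * (1 + lambda) / tau%:R &
          Delta * (1 + lambda) / tau%:R <= 2 * Delta / tau%:R] &
      [/\ 0 < delta, delta <= 1 / tau%:R & 1 / tau%:R <= 1 :> R]].
Proof.
move=> Wt hWt Delta delta bW bR.
have lambda2_lt1 : lambda ^+ 2 < 1 by nra.
have tau_gt0 : 0 < tau%:R :> R by rewrite ltr0n.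
have delta_gt0 : 0 < delta by rewrite divr_gt0// subr_gt0.
have nonexp k x : sqnorm (bW k *m x) <= sqnorm x.
  rewrite -[leRHS]mul1r; apply: sqnorm_tens1_le => y.
  by rewrite mul1r; exact: sqnorm_sub_avg_le.
have decay k x :
    sqnorm (transition bW (k + tau) k *m x) <= lambda ^+ 2 * sqnorm x.
  rewrite transition_tens1; apply: sqnorm_tens1_le => y.
  exact: sqnorm_mul_spectral_le.
have spec := gramian_spec htau lambda2_lt1 nonexp decay.
split.
- by move=> k; have [] := spec k.
- move=> k; have [_ lower upper] := spec k.
  split.
  + exact: loewner_leZ (ltW delta_gt0) lower.
  (* delta is chosen so that delta times the upper bound of the Gramian is 1. *)
  + have -> : 1%:M = delta *: (tau%:R / (1 - lambda ^+ 2) *: 1%:M) :> 'M[R]_(N * d).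
      rewrite scalerA (_ : _ * _ = 1) ?scale1r// /delta; field.
      by rewrite !gt_eqF//= subr_gt0.
    exact: loewner_leZ (ltW delta_gt0) upper.
  + rewrite -scalemxAr -scalemxAl -scalerBr; congr (_ *: _).
    exact: (gramian_lyapunov htau lambda2_lt1 nonexp decay).
- rewrite /delta /Delta; split; last 1 first.
  + by rewrite ler_pM2r ?invr_gt0//; nra.
  + by rewrite ler_pM2r ?invr_gt0//; nra.
  + by congr (_ / _); ring.
- split=> //.
  + by rewrite ler_pM2r ?invr_gt0// gerBl sqr_ge0.
  + by rewrite ler_pdivrMr// mul1r ler1n.
Qed.
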